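(* Let $\mathbf{P}$ be the semigroup on $\{a,e,0\}$ whose only nonzero products are $ea=a$ and $ee=e$, and let $\mathbf{Q}$ be the semigroup on $\{b,f,0\}$ whose only nonzero products are $bf=b$ and $ff=f$. Then $\mathbf{P}$ and $\mathbf{Q}$ are dualisable.
   Context: Semigroups are algebras with a single binary operation. Duality notions. Let $\mathbf{M}$ be a finite algebra and $\mathcal{Q}=\mathsf{ISP}(\mathbf{M})$ the quasivariety it generates (isomorphic copies of subalgebras of direct powers of $\mathbf{M}$). An alter ego $\mathbb{M}$ of $\mathbf{M}$ is a structure on the same universe $M$, carrying the discrete topology and some finitary operations, partial operations and relations, such that each $n$-ary operation is a homomorphism $\mathbf{M}^n\to\mathbf{M}$, each $n$-ary relation is a subalgebra of $\mathbf{M}^n$, and each $n$-ary partial operation is a homomorphism from a subalgebra of $\mathbf{M}^n$ into $\mathbf{M}$. Let $\mathcal{X}=\mathsf{IS_cP^+}(\mathbb{M})$ be the class of topologically and algebraically isomorphic copies of closed substructures of powers of $\mathbb{M}$ over nonempty index sets (product topology, pointwise structure). For $\mathbf{A}\in\mathcal{Q}$, $D(\mathbf{A})=\hom(\mathbf{A},\mathbf{M})$, a closed substructure of $\mathbb{M}^A$; for $\mathbb{A}\in\mathcal{X}$, $E(\mathbb{A})$ is the algebra of continuous homomorphisms (structure-preserving maps) $\mathbb{A}\to\mathbb{M}$, a subalgebra of $\mathbf{M}^{\mathbb{A}}$. $\mathbb{M}$ yields a duality on $\mathbf{A}$ if the (always injective) evaluation homomorphism $e:\mathbf{A}\to E(D(\mathbf{A}))$,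 $e_a(x)=x(a)$, is an isomorphism. $\mathbf{M}$ is dualisable (admits a natural duality) if some alter ego of $\mathbf{M}$ yields a duality on every $\mathbf{A}\in\mathcal{Q}$. *)

(* Defs.v *)
From HB Require Import structures.
From mathcomp Require Import all_boot.
From mathcomp Require Import all_classical topology.

Set Implicit Arguments.
Unset Strict Implicit.
Unset Printing Implicit Defensive.

Local Open Scope classical_set_scope.
Local Open Scope group_scope.

HB.structure Definition FinSemigroup := {S of Finite S & Semigroup S}.
Notation finSemigroupType := FinSemigroup.type.

(* The direct power S^I is I -> S with the pointwise product. *)
HB.instance Definition _ (I : Type) (S : magmaType) :=
  hasMul.Build (I -> S) (fun f g i => f i * g i).

Definition hom (A B : magmaType) : set (A -> B) :=
  [set f | {morph f : x y / x * y}].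

(* Algebras, and hence subalgebras, are nonempty. *)
Definition subalgebra (A : magmaType) (B : set A) : Prop :=
  B !=set0 /\ forall x y, B x -> B y -> B (x * y).

Definition iso_onto (A C : magmaType) (f : A -> C) (B : set C) : Prop :=
  hom f /\ set_bij [set: A] B f.

Definition ISP (M A : semigroupType) : Prop :=
  exists (I : Type) (B : set (I -> M)),
    subalgebra B /\ exists f : A -> (I -> M), iso_onto f B.

Record str_type := StrType {
  op_sym : Type;
  op_arity : op_sym -> nat;
  pop_sym : Type;
  pop_arity : pop_sym -> nat;
  rel_sym : Type;
  rel_arity : rel_sym -> nat }.

Record structure_on (s : str_type) (X : Type) := StructureOn {
  op (g : op_sym s) : ('I_(op_arity g) -> X) -> X;
  pdom (h : pop_sym s) : set ('I_(pop_arity h) -> X);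
  pop (h : pop_sym s) (x : 'I_(pop_arity h) -> X) : pdom x -> X;
  rel_on (r : rel_sym s) : set ('I_(rel_arity r) -> X) }.

Arguments op {s X} _ g _.
Arguments pdom {s X} _ h _.
Arguments pop {s X} _ {h x} _.
Arguments rel_on {s X} _ r _.

Section Structures.
Variable s : str_type.

Definition preserves (X Y : Type) (SX : structure_on s X)
    (SY : structure_on s Y) (f : X -> Y) : Prop :=
  [/\ forall (g : op_sym s) (x : 'I_(op_arity g) -> X),
        f (op SX g x) = op SY g (f \o x),
      forall (h : pop_sym s) (x : 'I_(pop_arity h) -> X) (hx : pdom SX h x),
        exists hfx : pdom SY h (f \o x), f (pop SX hx) = pop SY hfx
    & forall (r : rel_sym s) (x : 'I_(rel_arity r) -> X),
        rel_on SX r x -> rel_on SY r (f \o x)].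

Definition power_structure (X I : Type) (SX : structure_on s X) :
    structure_on s (I -> X) :=
  {| op := fun g x i => op SX g (fun k => x k i);
     pdom := fun h => [set x | forall i, pdom SX h (fun k => x k i)];
     pop := fun h x hx i => pop SX (hx i);
     rel_on := fun r => [set x | forall i, rel_on SX r (fun k => x k i)] |}.

Definition substructure (X : Type) (SX : structure_on s X) (Y : set X) : Prop :=
  (forall (g : op_sym s) (x : 'I_(op_arity g) -> X),
     (forall k, Y (x k)) -> Y (op SX g x)) /\
  (forall (h : pop_sym s) (x : 'I_(pop_arity h) -> X) (hx : pdom SX h x),
     (forall k, Y (x k)) -> Y (pop SX hx)).

Definition induced_structure (X : Type) (SX : structure_on s X) (Y : set X)
    (sY : substructure SX Y) : structure_on s (set_type Y) :=
  {| op := fun g (x : _ -> set_type Y) =>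
       exist _ (op SX g (fun k => val (x k)))
         (mem_set (sY.1 g _ (fun k => set_mem (valP (x k))))) : set_type Y;
     pdom := fun h =>
       [set x : _ -> set_type Y | pdom SX h (fun k => val (x k))];
     pop := fun h (x : _ -> set_type Y) hx =>
       exist _ (pop SX hx)
         (mem_set (sY.2 h _ hx (fun k => set_mem (valP (x k))))) : set_type Y;
     rel_on := fun r =>
       [set x : _ -> set_type Y | rel_on SX r (fun k => val (x k))] |}.

End Structures.

Record alter_ego (M : finSemigroupType) := AlterEgo {
  ae_type : str_type;
  ae_str : structure_on ae_type M;
  ae_op : forall g, hom (op ae_str g);
  ae_pdom : forall h, subalgebra (pdom ae_str h);
  ae_pop : forall h x y (hx : pdom ae_str h x) (hy : pdom ae_str h y)
    (hxy : pdom ae_str h (x * y)),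
    pop ae_str hxy = pop ae_str hx * pop ae_str hy;
  ae_rel : forall r, subalgebra (rel_on ae_str r) }.

Section Duality.
Variables (M : finSemigroupType) (MM : alter_ego M).

(* M carries the discrete topology and M^A the product topology. *)
Definition D (A : semigroupType) : set {ptws A -> discrete_topology M} :=
  @hom A M.

Lemma D_substructure (A : semigroupType) :
  substructure (power_structure A (ae_str MM)) (@D A).
Proof.
split=> [g x Dx a b | h x hx Dx a b] /=.
  rewrite -ae_op; congr (op _ _ _).
  by apply/funext => k; rewrite Dx.
have xM : (fun k => x k (a * b)) = (fun k => x k a) * (fun k => x k b).
  by apply/funext => k; rewrite Dx.
have hM : pdom (ae_str MM) h ((fun k => x k a) * (fun k => x k b)).
  by rewrite -xM; exact: hx.
rewrite -(ae_pop (hx a) (hx b) hM).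
by case: _ / xM (hx (a * b)) hM => h1 h2; rewrite (Prop_irrelevance h1 h2).
Qed.

Lemma D_closed (A : semigroupType) : closed (@D A).
Proof.
move=> f clf a b.
have nb c : nbhs f [set g : {ptws A -> discrete_topology M} | g c = f c].
  have /(_ [set f c]) := @proj_continuous A (fun=> discrete_topology M) c f.
  by apply; rewrite nbhs_principalE; exact/principal_filterP.
have [g [Dg [[gab ga] gb]]] :=
  clf _ (filterI (filterI (nb (a * b)) (nb a)) (nb b)).
by rewrite -gab -ga -gb; exact: Dg.
Qed.

Definition D_structure (A : semigroupType) :
    structure_on (ae_type MM) (set_type (@D A)) :=
  induced_structure (@D_substructure A).

Definition E (X : topologicalType) (SX : structure_on (ae_type MM) X) :
    set (X -> M) :=
  [set f | continuous (f : X -> discrete_topology M) /\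
           preserves SX (ae_str MM) f].

Definition evaluation (A : semigroupType) (a : A) : set_type (@D A) -> M :=
  fun x => val x a.

Definition yields_duality_on (A : semigroupType) : Prop :=
  iso_onto (@evaluation A) (E (D_structure A)).

End Duality.

Definition dualisable (M : finSemigroupType) : Prop :=
  exists MM : alter_ego M,
    forall A : semigroupType, ISP M A -> yields_duality_on MM A.

Inductive P_carrier := P_a | P_e | P_0.

Definition P_mul (x y : P_carrier) : P_carrier :=
  match x, y with
  | P_e, P_a => P_a
  | P_e, P_e => P_e
  | _, _ => P_0
  end.

Definition P_code (x : P_carrier) : 'I_3 :=
  match x with P_a => inord 0 | P_e => inord 1 | P_0 => inord 2 end.
Definition P_decode (i : 'I_3) : P_carrier :=
  match val i with 0 => P_a | 1 => P_e | _ => P_0 end.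
Lemma P_codeK : cancel P_code P_decode.
Proof. by case; rewrite /P_decode /= inordK. Qed.
Lemma P_mulA : associative P_mul.
Proof. by do 3 case. Qed.

HB.instance Definition _ := Finite.copy P_carrier (can_type P_codeK).
HB.instance Definition _ := isSemigroup.Build P_carrier P_mulA.

Definition P : finSemigroupType := P_carrier.

Inductive Q_carrier := Q_b | Q_f | Q_0.

Definition Q_mul (x y : Q_carrier) : Q_carrier :=
  match x, y with
  | Q_b, Q_f => Q_b
  | Q_f, Q_f => Q_f
  | _, _ => Q_0
  end.

Definition Q_code (x : Q_carrier) : 'I_3 :=
  match x with Q_b => inord 0 | Q_f => inord 1 | Q_0 => inord 2 end.
Definition Q_decode (i : 'I_3) : Q_carrier :=
  match val i with 0 => Q_b | 1 => Q_f | _ => Q_0 end.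
Lemma Q_codeK : cancel Q_code Q_decode.
Proof. by case; rewrite /Q_decode /= inordK. Qed.
Lemma Q_mulA : associative Q_mul.
Proof. by do 3 case. Qed.

HB.instance Definition _ := Finite.copy Q_carrier (can_type Q_codeK).
HB.instance Definition _ := isSemigroup.Build Q_carrier Q_mulA.

Definition Q : finSemigroupType := Q_carrier.

(* Main.v *)
(* In P the product x * y is y if x = e and 0 otherwise, so a homomorphism h
   from A to P is a pair of disjoint sets F = h^-1(e), N = h^-1(a) such that
   xy is in F iff x and y are, and xy is in N iff x is in F and y is in N.
   Take all ternary algebraic relations as the alter ego: a morphism f from D(A)
   to P then agrees with some evaluation on any three homomorphisms. Hence f
   respects products and flat meets of homomorphisms, and by continuity a nonempty
   fiber f^-1(p), p <> 0, is the up-set of a least homomorphism. If f^-1(a) is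
   nonempty, with least element (F, N), then N is a single orbit of the action of F,
   so it is directed downwards by c |-> uc; continuity at (F, N) and at the
   indicator of the filter generated by N shows that f is evaluation at any
   element lying far enough down in N. If f^-1(a) is empty, the least element
   of f^-1(e) plays this role. Finally, Q is anti-isomorphic to P. *)
From HB Require Import structures.
From mathcomp Require Import all_boot.
From mathcomp Require Import all_classical topology.
Require Import Defs.

Set Implicit Arguments.
Unset Strict Implicit.
Unset Printing Implicit Defensive.

Local Open Scope classical_set_scope.
Local Open Scope group_scope.

(** What preserving every ternary subalgebra of powers of [M] yields. [f] is total on [A -> M], but
    only its values at homomorphisms are constrained. *)
Definition interpolable3 (M A : semigroupType) (f : (A -> M) -> M) : Prop :=
  forall h1 h2 h3, hom h1 -> hom h2 -> hom h3 ->
    exists c, [/\ f h1 = h1 c, f h2 = h2 c & f h3 = h3 c].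

(** Continuity of [f] on the homomorphisms, for the pointwise topology with discrete values. *)
Definition finitely_determined (M A : semigroupType) (f : (A -> M) -> M) : Prop :=
  forall h, hom h -> exists s : seq A,
    forall k, hom k -> {in s, k =1 h} -> f k = f h.

Definition separating (M A : semigroupType) : Prop :=
  forall x y : A, (forall h : A -> M, hom h -> h x = h y) -> x = y.

(** * Homomorphisms into [P], flat meets and fibers *)

Section PInterpolation.
Variables (A : semigroupType) (f : (A -> P) -> P).
Hypotheses (sepA : separating P A) (loc : interpolable3 f)
  (cont : finitely_determined f).
Implicit Types (x y z u v c : A) (h k H : A -> P).

Lemma mulP_e (p q : P) : p * q = P_e <-> p = P_e /\ q = P_e.
Proof. by case: p; case: q; split=> // -[]. Qed.

Lemma mulP_a (p q : P) : p * q = P_a <-> p = P_e /\ q = P_a.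
Proof. by case: p; case: q; split=> // -[]. Qed.

Lemma P_ext (p q : P) :
  (p = P_e <-> q = P_e) -> (p = P_a <-> q = P_a) -> p = q.
Proof. by case: p q => [] [] //; intuition discriminate. Qed.

Lemma mulACl x y z : x * (y * z) = y * (x * z).
Proof.
by apply: sepA => h hh; rewrite !hh; case: (h x); case: (h y); case: (h z).
Qed.

Definition indicator (F N : set A) : A -> P :=
  fun x => if `[< F x >] then P_e else if `[< N x >] then P_a else P_0.

Lemma indicator_e F N x : indicator F N x = P_e <-> F x.
Proof. by rewrite /indicator; case: asboolP => [//|Fx]; case: asboolP. Qed.

Lemma indicator_a F N x : ~ (F x /\ N x) -> indicator F N x = P_a <-> N x.
Proof.
move=> FN; rewrite /indicator; case: asboolP => [Fx|_]; last by case: asboolP.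
by split=> // Nx; case: FN.
Qed.

Lemma hom_indicator (F N : set A) :
  (forall x y, F (x * y) <-> F x /\ F y) ->
  (forall x y, N (x * y) <-> F x /\ N y) ->
  (forall x, ~ (F x /\ N x)) -> hom (indicator F N).
Proof.
move=> FM NM dFN x y; apply: P_ext.
  by rewrite mulP_e !indicator_e.
by rewrite mulP_a indicator_e !indicator_a.
Qed.

Lemma homM_e h x y : hom h -> h (x * y) = P_e <-> h x = P_e /\ h y = P_e.
Proof. by move=> ->; rewrite mulP_e. Qed.

Lemma homM_a h x y : hom h -> h (x * y) = P_a <-> h x = P_e /\ h y = P_a.
Proof. by move=> ->; rewrite mulP_a. Qed.

(** [P] is medial, $(xy)(zw) = (xz)(yw)$, so its product is a homomorphism from $P^2$ to $P$. *)
Lemma hom_mul h k : hom h -> hom k -> hom (h * k).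
Proof.
move=> hh hk x y.
rewrite -[(h * k) (x * y)]/(h (x * y) * k (x * y)) hh hk.
rewrite -[(h * k) x]/(h x * k x) -[(h * k) y]/(h y * k y).
by case: (h x); case: (h y); case: (k x); case: (k y).
Qed.

(** Pointwise meet in the flat order with bottom [P_0], for nonempty [S]; the empty family would
    give the constant [P_e]. *)
Definition meet (S : set (A -> P)) : A -> P :=
  indicator [set x | forall h, S h -> h x = P_e]
            [set x | forall h, S h -> h x = P_a].

Definition flat_le h k : Prop := forall x, h x <> P_0 -> k x = h x.

Lemma meet_le S h : S h -> flat_le (meet S) h.
Proof.
move=> Sh x; rewrite /meet /indicator.
by case: asboolP => [/(_ _ Sh)//|_]; case: asboolP => [/(_ _ Sh)//|].
Qed.

Lemma meet_disj S x : S !=set0 ->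
  ~ ((forall h, S h -> h x = P_e) /\ (forall h, S h -> h x = P_a)).
Proof. by move=> [h Sh] [/(_ _ Sh) + /(_ _ Sh)] => ->. Qed.

Lemma hom_meet S : S !=set0 -> S `<=` @hom A P -> hom (meet S).
Proof.
move=> S0 Shom; apply: hom_indicator => /= [x y|x y|x]; last exact: meet_disj.
- split=> [SM|[Sx Sy] h Sh]; last by apply/(homM_e _ _ (Shom _ Sh)); split; auto.
  by split=> h Sh; have /(homM_e _ _ (Shom _ Sh))[] := SM _ Sh.
- split=> [SM|[Sx Sy] h Sh]; last by apply/(homM_a _ _ (Shom _ Sh)); split; auto.
  by split=> h Sh; have /(homM_a _ _ (Shom _ Sh))[] := SM _ Sh.
Qed.

Lemma meet2E h k x : meet [set h; k] x = P_0 \/ meet [set h; k] x = h x /\ h x = k x.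
Proof.
have [m0|m0] := pselect (meet [set h; k] x = P_0); [by left|right].
by rewrite (meet_le _ m0); [rewrite (meet_le _ m0)//; right|left].
Qed.

Lemma meet2_id h k x : h x = k x -> meet [set h; k] x = h x.
Proof.
move=> hk; apply: P_ext; rewrite ?indicator_e ?indicator_a /=.
- by split=> [|hx _ [->|->]//]; [apply; left|rewrite -hk].
- by split=> [|hx _ [->|->]//]; [apply; left|rewrite -hk].
- by apply: meet_disj; exists h; left.
Qed.

Lemma hom_meet2 h k : hom h -> hom k -> hom (meet [set h; k]).
Proof. by move=> hh hk; apply: hom_meet => [|_ [->|->]//]; exists h; left. Qed.

(** One element [c] interpolates [f] at [h], [k] and their meet; there [h] and [k] agree, so the
    meet keeps their common value. *)
Lemma f_meet2 h k : hom h -> hom k -> f h = f k -> f (meet [set h; k]) = f h.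
Proof.
move=> hh hk; have [c [-> -> ->]] := loc hh hk (hom_meet2 hh hk).
exact: meet2_id.
Qed.

Lemma f_mono h k : hom h -> hom k -> flat_le h k -> f h <> P_0 -> f k = f h.
Proof. by move=> hh hk le_hk; have [c [-> -> _]] := loc hh hk hk; exact: le_hk. Qed.

Lemma f_mul h k : hom h -> hom k -> f (h * k) = f h * f k.
Proof. by move=> hh hk; have [c [-> -> ->]] := loc hh hk (hom_mul hh hk). Qed.

Lemma f_const_e : f (fun=> P_e) = P_e.
Proof. by have hP : hom (fun _ : A => P_e) by []; have [c [-> _ _]] := loc hP hP hP. Qed.

(** Only points where [H] is nonzero matter: the meet of [H] and [h] agrees with [H] on all of [s],
    and monotonicity carries the value from the meet up to [h]. *)
Lemma finite_support H : hom H -> f H <> P_0 -> exists s : seq A,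
  forall h, hom h -> {in s, forall x, H x <> P_0 -> h x = H x} -> f h = f H.
Proof.
move=> hH fH0; have [s Hs] := cont hH; exists s => h hh hHs.
have hm := hom_meet2 hH hh.
have fm : f (meet [set H; h]) = f H.
  apply: Hs => // x xs; have [m0|[//]] := meet2E H h x.
  by case Hx0 : (H x) => //; rewrite meet2_id// hHs// Hx0.
rewrite -fm; apply: f_mono; rewrite ?fm//.
by apply: meet_le; right.
Qed.

(** The meet of the whole fiber is the candidate. By continuity there, it lies in the fiber as soon
    as some member agrees with it on a finite list; binary meets build such a member point by
    point. *)
Lemma least_fiber (p : P) : p <> P_0 -> (exists2 h, hom h & f h = p) ->
  exists H, [/\ hom H, f H = p & forall h, hom h -> f h = p -> flat_le H h].
Proof.
move=> p0 [h0 hh0 fh0]; set S := [set h : A -> P | hom h /\ f h = p].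
have Sh0 : S h0 by [].
have hH : hom (meet S) by apply: hom_meet => [|h []//]; exists h0.
exists (meet S); split=> // [|h hh fh]; last exact: meet_le.
have [s Hs] := cont hH.
suff [k [hk fk] ks] : exists2 k, S k & {in s, forall x, meet S x = P_0 -> k x = P_0}.
  rewrite -fk -(Hs k) // => x xs.
  have [m0|m0] := pselect (meet S x = P_0); last exact: meet_le.
  by rewrite m0; exact: ks.
elim: s {Hs} => [|y s [k Sk ks]]; first by exists h0.
have [|my0] := pselect (meet S y = P_0); last first.
  by exists k => // x; rewrite inE => /predU1P[->//|]; exact: ks.
move=> my0; have [ky0|ky0] := pselect (k y = P_0).
  by exists k => // x; rewrite inE => /predU1P[->//|]; exact: ks.
have [k' Sk' k'y] : exists2 k', S k' & k' y <> k y.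
  apply: contrapT => /forall2NP nk; suff : meet S y = k y by rewrite my0 => /esym.
  have eqk h : S h -> h y = k y by move=> Sh; case: (nk h) => // /contrapT.
  apply: P_ext; rewrite ?indicator_e ?indicator_a /=.
  - by split=> [|ke h /eqk ->//]; exact.
  - by split=> [|ke h /eqk ->//]; exact.
  - by apply: meet_disj; exists h0.
case: Sk Sk' => hk fk [hk' fk'].
exists (meet [set k; k']).
  by split; [exact: hom_meet2|rewrite f_meet2// fk fk'].
move=> x; rewrite inE => /predU1P[->|xs] mx0.
  by have [//|[_ kk']] := meet2E k k' y; case: k'y.
by have [//|[-> _]] := meet2E k k' x; exact: ks.
Qed.

(** * The interpolating element, by cases on the fiber over [P_a] *)

Lemma fiber_a_empty : (forall h, hom h -> f h <> P_a) ->
  exists c, forall h, hom h -> f h = h c.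
Proof.
move=> fNa.
have [H [hH fH leH]] : exists H, [/\ hom H, f H = P_e
    & forall h, hom h -> f h = P_e -> flat_le H h].
  by apply: least_fiber => //; exists (fun=> P_e) => //; exact: f_const_e.
(* [H * H] lies in the fiber over [P_e], hence above [H], but $aa = 0$. *)
have HNa x : H x <> P_a.
  move=> Hx; suff : (H * H) x = P_a by rewrite -[(H * H) x]/(H x * H x) Hx.
  by rewrite (leH (H * H)) ?Hx//; [exact: hom_mul|rewrite f_mul// fH].
have [|s sP] := finite_support hH; first by rewrite fH.
suff [z Hz zs] : exists2 z, H z = P_e & forall h, hom h -> h z = P_e ->
    {in s, forall x, H x <> P_0 -> h x = H x}.
  (* Squaring sends [P_a] to [P_0], so evaluation at [z * z] never takes the value [P_a]. *)
  exists (z * z) => h hh; apply: P_ext.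
    rewrite homM_e//; split=> [fh|[hz _]]; first by rewrite (leH h) ?Hz.
    by rewrite (sP h)// => *; exact: zs.
  by rewrite homM_a//; split=> [/fNa//|[->]].
elim: s {sP} => [|y s [z Hz zs]].
  by have [c [fHc _ _]] := loc hH hH hH; exists c; rewrite -?fHc.
case Hy : (H y); first by have /HNa := Hy.
  exists (y * z) => [|h hh /(homM_e _ _ hh) [hy hz] x].
    exact/homM_e.
  by rewrite inE => /predU1P[->|xs]; [rewrite hy Hy|exact: zs].
exists z => // h hh hz x.
by rewrite inE => /predU1P[->|xs]; [rewrite Hy|exact: zs].
Qed.

(** Evaluation at [z] lies under evaluation at [x] in the flat order. *)
Definition below z x : Prop := forall h, hom h -> h z <> P_0 -> h x = h z.

Lemma below_mul u x : below (u * x) x.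
Proof. by move=> h hh; rewrite hh; case: (h u); case: (h x). Qed.

Lemma fiber_a_nonempty : (exists2 h, hom h & f h = P_a) ->
  exists c, forall h, hom h -> f h = h c.
Proof.
case/least_fiber => // H0 [hH0 fH0 leH0].
pose F := [set x | H0 x = P_e]; pose N := [set x | H0 x = P_a].
have FM x y : F (x * y) <-> F x /\ F y by exact: homM_e.
have NM x y : N (x * y) <-> F x /\ N y by exact: homM_a.
have FN x : ~ (F x /\ N x) by case; rewrite /F /N /= => ->.
have [c0 Nc0] : exists c, N c.
  by have [c [fc _ _]] := loc hH0 hH0 hH0; exists c; rewrite /N /= -fc.
(* The elements having a common [F]-translate with [c0]; the disjunct [y = c0] covers an empty
   [F]. *)
pose K := [set y | N y /\ (y = c0 \/ exists u v, [/\ F u, F v & u * c0 = v * y])].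
(* Replacing N by the class K or by its complement in N gives two
   homomorphisms below H0; f takes the value a at one of them, so N = K. *)
have KM x y : K (x * y) <-> F x /\ K y.
  split=> [[/NM[Fx Ny] Kxy]|[Fx [Ny Ky]]].
    split=> //; split=> //; case: Kxy => [xyE|[u [v [Fu Fv uvE]]]].
      right; exists x, (x * x); split=> //; first exact/FM.
      by rewrite -mulgA xyE.
    by right; exists u, (v * x); rewrite -mulgA; split=> //; exact/FM.
  split; first exact/NM.
  right; case: Ky => [->|[u [v [Fu Fv uvE]]]].
    by exists (x * x), x; rewrite mulgA; split=> //; exact/FM.
  exists (x * u), v; split=> //; first exact/FM.
  by rewrite -mulgA uvE mulACl.
have hK : hom (indicator F K).
  by apply: hom_indicator => // x [Fx [Nx _]]; exact: (FN x).
have FNK x : ~ (F x /\ (N `\` K) x) by case=> Fx [Nx _]; exact: (FN x).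
have hR : hom (indicator F (N `\` K)).
  apply: hom_indicator => // x y; split.
    move=> [/NM[Fx Ny] nK]; split=> //; split=> // Ky.
    by apply: nK; exact/KM.
  by move=> [Fx [Ny nK]]; split; [exact/NM|move=> /KM[]].
have NK : N `<=` K.
  have [c [fH0c fKc fRc]] := loc hH0 hK hR.
  have Nc : N c by rewrite /N /= -fH0c.
  have [Kc|nKc] := pselect (K c).
    move: fKc; rewrite (_ : indicator F K c = P_a); last first.
      by apply/indicator_a => // -[Fc _]; exact: (FN c).
    move=> /(leH0 _ hK) le y Ny; apply/(@indicator_a F).
      by move=> -[Fy _]; exact: (FN y).
    by rewrite le Ny.
  move: fRc; rewrite (_ : indicator F (N `\` K) c = P_a); last exact/indicator_a.
  move=> /(leH0 _ hR) le.
  have /(indicator_a (@FNK c0))[_] : indicator F (N `\` K) c0 = P_a by rewrite le Nc0.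
  by case; split=> //; left.
(* A left multiple lies below its right factor. Translates commute by [mulACl], so links of [x] and
   [y] to [c0] combine into a common left multiple. *)
have dirN x y : N x -> N y -> exists z, [/\ N z, below z x & below z y].
  move=> Nx Ny; case: (NK _ Nx) => _ [->|[u [v [Fu Fv uvE]]]];
    case: (NK _ Ny) => _ [->|[u' [v' [Fu' Fv' uvE']]]].
  - by exists c0; split.
  - exists (u' * c0); split; [exact/NM|exact: below_mul|].
    by rewrite uvE'; exact: below_mul.
  - exists (u * c0); split; [exact/NM| |exact: below_mul].
    by rewrite uvE; exact: below_mul.
  - exists (u * (u' * c0)); split; first by apply/NM; split=> //; exact/NM.
      by rewrite mulACl uvE mulgA; exact: below_mul.
    by rewrite uvE' mulgA; exact: below_mul.
have [c1 Nc1 c1P] : exists2 c, N c & forall h, hom h -> h c = P_a -> f h = P_a.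
  have [|s sP] := finite_support hH0; first by rewrite fH0.
  suff [c Nc cs] : exists2 c, N c & forall h, hom h -> h c = P_a ->
      {in s, forall x, H0 x <> P_0 -> h x = H0 x}.
    by exists c => // h hh hc; rewrite (sP h)// => *; exact: cs.
  elim: s {sP} => [|y s [c Nc cs]]; first by exists c0.
  (* For the value [P_a] take a lower bound in [N], for [P_e] multiply by [y]; [P_0] imposes
     nothing. *)
  case Hy : (H0 y).
  - have [z [Nz zy zc]] := dirN _ _ Hy Nc; exists z => // h hh hz x.
    rewrite inE => /predU1P[->|xs]; first by rewrite (zy h) ?hz ?Hy.
    by apply: cs => //; rewrite zc ?hz.
  - exists (y * c) => [|h hh /(homM_a _ _ hh)[hy hc] x]; first exact/NM.
    by rewrite inE => /predU1P[->|xs]; [rewrite hy Hy|exact: cs].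
  - exists c => // h hh hc x.
    by rewrite inE => /predU1P[->|xs]; [rewrite Hy|exact: cs].
(* The filter generated by N: f is e on its indicator, so by continuity on every
   h that is e at some element sufficiently far down in N. *)
pose F1 := [set x | exists2 z, N z & forall h, hom h -> h z = P_e -> h x = P_e].
have F1M x y : F1 (x * y) <-> F1 x /\ F1 y.
  split=> [[z Nz zP]|[[z Nz zP] [w Nw wP]]].
    by split; exists z => // h hh /(zP _ hh) /(homM_e _ _ hh)[].
  have [t [Nt tz tw]] := dirN _ _ Nz Nw.
  exists t => // h hh ht; apply/homM_e => //.
  by split; [apply: zP; rewrite ?tz ?ht|apply: wP; rewrite ?tw ?ht].
have hH1 : hom (indicator F1 set0).
  by apply: hom_indicator => // [x y|x []//]; split=> // -[].
(* Interpolating at [H0] as well forces [c] into [N], which is contained in [F1]. *)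
have fH1 : f (indicator F1 set0) = P_e.
  have [c [fH0c -> _]] := loc hH0 hH1 hH1.
  by apply/indicator_e; exists c => //; rewrite /N /= -fH0c.
have [c2 Nc2 c2P] : exists2 c, N c & forall h, hom h -> h c = P_e -> f h = P_e.
  have [|s sP] := finite_support hH1; first by rewrite fH1.
  suff [c Nc cs] : exists2 c, N c & forall h, hom h -> h c = P_e ->
      {in s, forall x, F1 x -> h x = P_e}.
    exists c => // h hh hc; rewrite (sP h)// => x xs.
    case H1x : (indicator F1 set0 x) => // _; last exact/cs/indicator_e/H1x.
    have nd : ~ (F1 x /\ set0 x) by case.
    by move/(indicator_a nd): H1x.
  elim: s {sP} => [|y s [c Nc cs]]; first by exists c0.
  have [[w Nw wy]|nF1y] := pselect (F1 y).
    have [z [Nz zw zc]] := dirN _ _ Nw Nc; exists z => // h hh hz x.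
    rewrite inE => /predU1P[-> _|xs]; first by rewrite wy ?zw ?hz.
    by apply: cs => //; rewrite zc ?hz.
  by exists c => // h hh hc x; rewrite inE => /predU1P[->//|]; exact: cs.
have [z [Nz z1 z2]] := dirN _ _ Nc1 Nc2.
exists z => h hh; apply: P_ext; split=> [fh|hz].
(* Here $f(h H_0) = ea = a$, so [h * H0] is above [H0] and takes the value [P_a] at [z]; this forces
   [h z = P_e]. *)
- have hhH0 := hom_mul hh hH0.
  have : (h * H0) z = P_a.
    by rewrite (leH0 _ hhH0) ?Nz// f_mul// fh fH0.
  by rewrite -[(h * H0) z]/(h z * H0 z) => /mulP_a[].
- by apply: c2P; rewrite ?z2 ?hz.
- by rewrite (leH0 h) ?Nz.
- by apply: c1P; rewrite ?z1 ?hz.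
Qed.

Lemma P_interpolation : exists c, forall h, hom h -> f h = h c.
Proof.
have [/fiber_a_nonempty//|nfa] := pselect (exists2 h, hom h & f h = P_a).
by apply: fiber_a_empty => h hh fh; apply: nfa; exists h.
Qed.

End PInterpolation.

(** * The ternary alter ego and the reduction of duality to interpolation *)

Definition ternary_type (M : finSemigroupType) : str_type :=
  {| op_sym := void; op_arity := fun=> 0;
     pop_sym := void; pop_arity := fun=> 0;
     rel_sym := {r : set ('I_3 -> M) | subalgebra r}; rel_arity := fun=> 3 |}.

Definition ternary_structure (M : finSemigroupType) :
    structure_on (ternary_type M) M :=
  @StructureOn (ternary_type M) M (fun g : void => match g with end)
    (fun h : void => match h with end) (fun h : void => match h with end)
    (fun r => sval r).

Definition ternary_alter_ego (M : finSemigroupType) : alter_ego M :=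
  @AlterEgo M (ternary_type M) (ternary_structure M)
    (fun g : void => match g with end) (fun h : void => match h with end)
    (fun h : void => match h with end) (fun r => svalP r).

(** The sets containing all functions that agree with [g] on some finite list form a filter.
    Convergence to [g] is tested one coordinate at a time, where a one-point list suffices. *)
Lemma nbhs_ptws (A T : choiceType) (g : {ptws A -> discrete_topology T})
    (V : set {ptws A -> discrete_topology T}) :
  nbhs g V -> exists s : seq A, forall k, {in s, k =1 g} -> V k.
Proof.
pose G : set_system {ptws A -> discrete_topology T} :=
  [set W | exists s : seq A, forall k, {in s, k =1 g} -> W k].
have GF : Filter G.
  split; first by exists [::].
    move=> W W' [s sW] [s' sW']; exists (s ++ s') => k kg.
    by split; [apply: sW|apply: sW'] => x xs; apply: kg; rewrite mem_cat xs ?orbT.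
  by move=> W W' WW' [s sW]; exists s => k /sW /WW'.
suff /(_ V) : G --> g by exact.
apply/cvg_sup => a U [_ [[W oW <-] Wg WU]].
by apply: filterS WU _; exists [:: a] => k /(_ a (mem_head _ _)) /= ->.
Qed.

Lemma ISP_separating (M A : semigroupType) : ISP M A -> separating M A.
Proof.
move=> [I [B [_ [phi [hphi [_ phi_inj _]]]]]] x y xy.
apply: phi_inj; rewrite ?inE//; apply/funext => i.
by apply: (xy (fun z => phi z i)) => u v; rewrite hphi.
Qed.

Lemma ISP_inhabited (M A : semigroupType) : ISP M A -> inhabited A.
Proof.
by move=> [I [B [[[b Bb] _] [phi [_ [_ _ /(_ _ Bb) [a _ _]]]]]]]; exists.
Qed.

Section Evaluation.
Variables (M : finSemigroupType) (A : semigroupType).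

Lemma continuous_evaluation (a : A) :
  continuous (@evaluation M A a : set_type (@D M A) -> discrete_topology M).
Proof.
move=> u; apply: (@continuous_comp (set_type (@D M A))
    {ptws A -> discrete_topology M} (discrete_topology M)
    set_val (@proj A (fun=> discrete_topology M) a)).
  exact: initial_continuous.
exact: proj_continuous.
Qed.

Lemma continuous_finitely_determined (f : set_type (@D M A) -> M) :
  continuous (f : _ -> discrete_topology M) ->
  forall u : set_type (@D M A), exists s : seq A,
    forall v : set_type (@D M A),
      {in s, forall a, evaluation a v = evaluation a u} -> f v = f u.
Proof.
move=> fc u.
have : nbhs u [set v | f v = f u].
  apply: (fc u [set f u]).
  by rewrite nbhs_principalE; exact/principal_filterP.
case=> _ [[W oW <-] Wu WV].
have [s sW] := nbhs_ptws (open_nbhs_nbhs (conj oW Wu)).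
by exists s => v /sW /WV.
Qed.

End Evaluation.

Lemma dualisable_of_interpolation (M : finSemigroupType) :
  (forall (A : semigroupType) (f : (A -> M) -> M), separating M A ->
     interpolable3 f -> finitely_determined f ->
     exists c, forall h, hom h -> f h = h c) ->
  dualisable M.
Proof.
move=> interp; exists (ternary_alter_ego M) => A AM.
pose lift (h : A -> M) (hh : hom h) : set_type (@D M A) := SigSub (mem_set hh).
have homD (x : set_type (@D M A)) : hom (val x : A -> M) by exact: set_mem (valP x).
split; first by move=> a b; apply/funext => x; exact: homD.
split=> [a _|a b _ _ ab|f [fc [_ _ fr]]].
- split; first exact: continuous_evaluation.
  by split=> [[]|[]|r x]; exact.
- apply: (ISP_separating AM) => h hh.
  exact: (congr1 (fun g => g (lift h hh)) ab).
have [a0] := ISP_inhabited AM.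
(* The value [h a0] off the homomorphisms is an arbitrary default. *)
pose F (h : A -> M) : M := if pselect (hom h) is left hh then f (lift h hh) else h a0.
have FE h (hh : hom h) : F h = f (lift h hh).
  by rewrite /F; case: pselect => // hh'; congr f; exact: val_inj.
have [||c Fc] := interp A F (ISP_separating AM).
- move=> h1 h2 h3 hh1 hh2 hh3.
  pose hs (i : 'I_3) : set_type (@D M A) :=
    match val i with 0 => lift h1 hh1 | 1 => lift h2 hh2 | _ => lift h3 hh3 end.
  (* The image of [A] under the three homomorphisms jointly; membership of the triple of values of
     [f] is exactly interpolation. *)
  pose r : set ('I_3 -> M) := [set y | exists a, y = fun i => val (hs i) a].
  have rS : subalgebra r.
    split; first by exists (fun i => val (hs i) a0); exists a0.
    move=> _ _ [a ->] [b ->]; exists (a * b).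
    by apply/funext => i; rewrite homD.
  have [|c fhs] := fr (exist _ r rS) hs; first by move=> a; exists a.
  exists c; rewrite !FE; split.
  + exact: (congr1 (fun y => y (@Ordinal 3 0 isT)) fhs).
  + exact: (congr1 (fun y => y (@Ordinal 3 1 isT)) fhs).
  + exact: (congr1 (fun y => y (@Ordinal 3 2 isT)) fhs).
- move=> h hh; have [s sP] := continuous_finitely_determined fc (lift h hh).
  by exists s => k hk kh; rewrite !FE; exact: sP.
exists c => //; apply/funext => x.
rewrite /evaluation -Fc// FE; congr f; exact: val_inj.
Qed.

Lemma dualisable_P : dualisable P.
Proof. by apply: dualisable_of_interpolation => A f; exact: P_interpolation. Qed.

(** * Transfer to [Q] by reversing the product *)

Definition opposite (A : Type) : Type := A.

Section Opposite.
Variable A : semigroupType.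

Definition opposite_mul (x y : opposite A) : opposite A := (y : A) * (x : A).

Lemma opposite_mulA : associative opposite_mul.
Proof. by move=> x y z; rewrite /opposite_mul mulgA. Qed.

HB.instance Definition _ := Choice.copy (opposite A) A.
HB.instance Definition _ := isSemigroup.Build (opposite A) opposite_mulA.

End Opposite.

Definition P_of_Q (q : Q) : P :=
  match q with Q_b => P_a | Q_f => P_e | Q_0 => P_0 end.

Definition Q_of_P (p : P) : Q :=
  match p with P_a => Q_b | P_e => Q_f | P_0 => Q_0 end.

Lemma P_of_QK : cancel P_of_Q Q_of_P. Proof. by case. Qed.

Lemma Q_of_PK : cancel Q_of_P P_of_Q. Proof. by case. Qed.

Lemma P_of_QM (p q : Q) : P_of_Q (p * q) = P_of_Q q * P_of_Q p.
Proof. by case: p; case: q. Qed.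

Lemma Q_of_PM (p q : P) : Q_of_P (p * q) = Q_of_P q * Q_of_P p.
Proof. by case: p; case: q. Qed.

Lemma dualisable_Q : dualisable Q.
Proof.
apply: dualisable_of_interpolation => A f sepA loc fd.
have homP (h : A -> Q) : hom h -> hom (P_of_Q \o h : opposite A -> P).
  by move=> hh x y; rewrite /= hh P_of_QM.
have homQ (h : opposite A -> P) : hom h -> hom (Q_of_P \o h : A -> Q).
  by move=> hh x y; rewrite /= -Q_of_PM -hh.
(* Conjugate of [f] under the bijection between homomorphisms from [A] to [Q] and from [opposite A]
   to [P]. *)
pose g (h : opposite A -> P) : P := P_of_Q (f (Q_of_P \o h)).
have [|h1 h2 h3 /homQ hh1 /homQ hh2 /homQ hh3|h /homQ hh|c gc] :=
  @P_interpolation (opposite A) g.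
- move=> x y xy; apply: sepA => h /homP /xy.
  exact: (can_inj P_of_QK).
- have [c [e1 e2 e3]] := loc _ _ _ hh1 hh2 hh3.
  by exists c; rewrite /g e1 e2 e3 /= !Q_of_PK.
- have [s sP] := fd _ hh; exists s => k /homQ hk kh.
  by rewrite /g sP// => x xs /=; rewrite kh.
exists c => h hh; apply: (can_inj P_of_QK).
rewrite -[RHS](gc _ (homP _ hh)) /g.
by congr (P_of_Q (f _)); apply/funext => x /=; rewrite P_of_QK.
Qed.

Theorem theorem9p2 : dualisable P /\ dualisable Q.
Proof. by split; [exact: dualisable_P|exact: dualisable_Q]. Qed.
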